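(* Let $\mathbb U$ be the Urysohn universal space and let $\mathcal C\subset\mathcal{DS}_{\operatorname{Iso}}(\mathbb U)$ be the set of classes $\tilde f$ such that $f\in\mathcal{DS}(\mathbb U)$ is a continuous map $M(f)\to M(f)$. Then the restriction of $\mathrm{D}_{\tilde H}$ to $\mathcal C$ is topologically equivalent to the $C^0$-Gromov-Hausdorff distance $d_{GH^0}$, i.e. $\mathrm{D}_{\tilde H}$ and $d_{GH^0}$ induce the same topology on $\mathcal C$.
   Context: An isometry is a surjective distance-preserving map. A metric space $\mathbb V$ is universal if it contains an isometric copy of every separable metric space, and ultrahomogeneous if every isometry $\varphi:A\to B$ between compact subsets of $\mathbb V$ extends to an isometry $\mathbb V\to\mathbb V$. The Urysohn universal space $(\mathbb U,\operatorname{dist})$ is the complete separable metric space, unique up to isometry, that is universal and ultrahomogeneous. On $\mathbb U^2$ use the max-metric $\operatorname{dist}_2((a,b),(c,d))=\max\{\operatorname{dist}(a,c),\operatorname{dist}(b,d)\}$; let $\pi_1,\pi_2$ be the coordinate projections. $\mathcal{DS}(\mathbb U)$ is the set of nonempty compact $f\subset\mathbb U^2$ with $\pi_1(f)=\pi_2(f)$, and $M(f)=\pi_1(f)=\pi_2(f)$; $\mathrm{D_H}$ is the Hausdorff distance on $\mathcal{DS}(\mathbb U)$ associated to $\operatorname{dist}_2$. Functions are identified with their graphs. On $\mathcal{DS}(\mathbb U)$, $f\sim g$ means that there is an isometry $\varphi:M(f)\to M(g)$ with $\varphi^{-1}g\varphi=f$, i.e. $(x,y)\in f\iff(\varphi(x),\varphi(y))\in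 g$. $\mathcal{DS}_{\operatorname{Iso}}(\mathbb U)=\mathcal{DS}(\mathbb U)/\sim$, $\tilde f$ is the class of $f$, and $\mathrm{D}_{\tilde H}(\tilde f,\tilde g)=\inf\{\mathrm{D_H}(f',g'): f'\sim f,\ g'\sim g\}$ (a metric on $\mathcal{DS}_{\operatorname{Iso}}(\mathbb U)$). For metric spaces $(X,d^X),(Y,d^Y)$, a function $\varphi:X\to Y$ (not necessarily continuous) is an $\epsilon$-isometry if $|d^Y(\varphi(x),\varphi(x'))-d^X(x,x')|<\epsilon$ for all $x,x'\in X$ and $d^Y_H(\varphi(X),Y)<\epsilon$, where $d^Y_H$ is the Hausdorff distance $d^Y_H(A,B)=\inf\{r>0:A\subseteq B_r(B),\ B\subseteq B_r(A)\}$ for subsets of $Y$, $B_r(A)$ denoting the union of the open $r$-balls centred at points of $A$. $\operatorname{Iso}_\epsilon(X,Y)$ is the set of $\epsilon$-isometries. For functions $u,v:A\to B$ into a metric space, $\operatorname{dist}_{C^0}(u,v)=\sup_{a\in A}\operatorname{dist}(u(a),v(a))$. For continuous maps $f:X\to X$, $g:Y\to Y$ of compact metric spaces, $d_{GH^0}(f,g)$ is the infimum of the $\epsilon>0$ for which there are $\varphi\in\operatorname{Iso}_\epsilon(X,Y)$ and $\psi\in\operatorname{Iso}_\epsilon(Y,X)$ with $\operatorname{dist}_{C^0}(g\varphi,\varphi f)<\epsilon$ and $\operatorname{dist}_{C^0}(\psi g,f\psi)<\epsilon$. It is invariant under isometric conjugacy, hence defined on $\mathcal C$; it is symmetric, vanishes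 exactly on isometrically conjugate maps, and satisfies $d_{GH^0}(f,g)\le 2(d_{GH^0}(f,h)+d_{GH^0}(h,g))$. The topology it induces on $\mathcal C$ is: $U\subset\mathcal C$ is open iff for every $\tilde g\in U$ there is $r>0$ such that $\{\tilde f\in\mathcal C:d_{GH^0}(f,g)<r\}\subset U$. *)

(* Defs.v *)
From HB Require Import structures.
From mathcomp Require Import all_boot all_order all_algebra generic_quotient.
From mathcomp Require Import all_classical all_reals all_analysis.

Set Implicit Arguments.
Unset Strict Implicit.
Unset Printing Implicit Defensive.

Import Order.TTheory GRing.Theory Num.Theory.

Local Open Scope classical_set_scope.
Local Open Scope ring_scope.
Local Open Scope ereal_scope.
Local Open Scope quotient_scope.

(* The library gives subsets and binary products a pseudometric structure; they
   are made into metric spaces here, with the restricted distance and with the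
   max-distance respectively. *)
Section subset_metric.
Context {R : realType} {X : metricType R} (A : set X).

Let sub_mdist (x y : A) : R := mdist (set_val x) (set_val y).

Let sub_mdist_ge0 x y : (0 <= sub_mdist x y)%R.
Proof. exact: mdist_ge0. Qed.

Let sub_mdist_positivity x y : sub_mdist x y = 0%R -> x = y.
Proof. by move=> /mdist_positivity/val_inj. Qed.

Let sub_ballEmdist (x : A) d : ball x d = [set y | (sub_mdist x y < d)%R].
Proof.
change (ball x d) with [set y : A | ball (set_val x) d (set_val y)].
by rewrite ballEmdist.
Qed.

HB.instance Definition _ := @PseudoMetric_isMetric.Build R A
  sub_mdist sub_mdist_ge0 sub_mdist_positivity sub_ballEmdist.

Lemma mdist_subE (x y : A) : mdist x y = mdist (set_val x) (set_val y).
Proof. by []. Qed.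

End subset_metric.

Section product_metric.
Context {R : realType} {X Y : metricType R}.

Let prod_mdist (p q : X * Y) : R := Num.max (mdist p.1 q.1) (mdist p.2 q.2).

Let prod_mdist_ge0 p q : (0 <= prod_mdist p q)%R.
Proof. by rewrite le_max mdist_ge0. Qed.

Let prod_mdist_positivity p q : prod_mdist p q = 0%R -> p = q.
Proof.
case: p q => [a b] [c d] E.
have : (prod_mdist (a, b) (c, d) <= 0)%R by rewrite E.
rewrite ge_max /= => /andP[ac bd]; congr (_, _); apply: mdist_positivity;
  by apply/eqP; rewrite eq_le mdist_ge0 andbT.
Qed.

Let prod_ballEmdist (p : X * Y) d :
  ball p d = [set q | (prod_mdist p q < d)%R].
Proof.
apply/seteqP; split=> q /=; rewrite /ball /= /prod_ball !ballEmdist /=.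
  by case=> ? ?; rewrite gt_max; apply/andP.
by rewrite gt_max => /andP.
Qed.

HB.instance Definition _ := @PseudoMetric_isMetric.Build R (X * Y)%type
  prod_mdist prod_mdist_ge0 prod_mdist_positivity prod_ballEmdist.

Lemma mdist_prodE (p q : X * Y) :
  mdist p q = Num.max (mdist p.1 q.1) (mdist p.2 q.2).
Proof. by []. Qed.

End product_metric.

Definition isometry (R : realType) (X Y : metricType R) (phi : X -> Y) : Prop :=
  (forall x x', mdist (phi x) (phi x') = mdist x x') /\
  (forall y, exists x, phi x = y).

Definition complete_space (T : uniformType) : Prop :=
  forall F : set_system T, ProperFilter F -> cauchy F -> exists l : T, F --> l.

Definition separable (T : topologicalType) : Prop :=
  exists D : set T, countable D /\ dense D.

Definition universal (R : realType) (V : metricType R) : Prop :=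
  forall X : metricType R, separable X ->
  exists (A : set V) (phi : X -> A), isometry phi.

Definition ultrahomogeneous (R : realType) (V : metricType R) : Prop :=
  forall A B : set V, compact A -> compact B ->
  forall phi : A -> B, isometry phi ->
  exists Phi : V -> V,
    isometry Phi /\ forall x : A, Phi (set_val x) = set_val (phi x).

Definition urysohn (R : realType) (U : metricType R) : Prop :=
  [/\ complete_space U, separable U, universal U & ultrahomogeneous U].

(* Infima and suprema are taken in the extended reals, so that the infimum of
   an empty set is +oo (rather than the default value 0 of [inf]). *)
Definition hausdorff_dist (R : realType) (T : metricType R) (A B : set T) :
    \bar R :=
  ereal_inf [set r%:E | r in [set r : R | [/\ (0 < r)%R,
    A `<=` \bigcup_(b in B) ball b r & B `<=` \bigcup_(a in A) ball a r]]].

Definition eps_isometry (R : realType) (X Y : metricType R) (e : R)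
    (phi : X -> Y) : Prop :=
  (forall x x', (`|mdist (phi x) (phi x') - mdist x x'| < e)%R) /\
  hausdorff_dist (range phi) [set: Y] < e%:E.

Definition dist_C0 (R : realType) (A : Type) (B : metricType R) (u v : A -> B) :
    \bar R :=
  ereal_sup (range (fun a => (mdist (u a) (v a))%:E)).

Definition GH0_dist (R : realType) (X Y : metricType R)
    (f : X -> X) (g : Y -> Y) : \bar R :=
  ereal_inf [set e%:E | e in [set e : R | (0 < e)%R /\
    exists (phi : X -> Y) (psi : Y -> X),
      [/\ eps_isometry e phi, eps_isometry e psi,
          dist_C0 (g \o phi) (phi \o f) < e%:E &
          dist_C0 (psi \o g) (f \o psi) < e%:E]]].

Section DS.
Context {R : realType} (U : metricType R).

Definition DS_set : set (set (U * U)) :=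
  [set f | [/\ f !=set0, compact f & fst @` f = snd @` f]].

Definition DS : choiceType := set_type DS_set.

Definition DS_rel (f : DS) : set (U * U) := set_val f.

Definition DS_dom (f : DS) : set U := fst @` DS_rel f.

Definition DH (f g : DS) : \bar R := hausdorff_dist (DS_rel f) (DS_rel g).

(* [phi^-1 g phi = f], as relations. *)
Definition DS_sim (f g : DS) : Prop :=
  exists phi : DS_dom f -> DS_dom g, isometry phi /\
    forall x y : DS_dom f, DS_rel f (set_val x, set_val y) <->
      DS_rel g (set_val (phi x), set_val (phi y)).

Lemma DS_sim_refl f : DS_sim f f.
Proof. by exists id; split=> //; split=> // y; exists y. Qed.

Lemma DS_sim_inv f g (phi : DS_dom f -> DS_dom g) : isometry phi ->
  exists psi : DS_dom g -> DS_dom f,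
    [/\ isometry psi, cancel phi psi & cancel psi phi].
Proof.
move=> [d s]; pose psi y := xget (projT1 (cid (s y))) [set x | phi x = y].
have psiK : cancel psi phi.
  by move=> y; rewrite /psi; case: xgetP => [x _ //|]; case: cid => /= x <- /(_ x).
have inj : injective phi.
  by move=> x x' e; apply: mdist_positivity; rewrite -d e mdistxx.
have phiK : cancel phi psi by move=> x; apply: inj; rewrite psiK.
exists psi; split=> //; split=> [x x'|y]; first by rewrite -d !psiK.
by exists (phi y).
Qed.

Lemma DS_sim_sym f g : DS_sim f g -> DS_sim g f.
Proof.
case=> phi [/DS_sim_inv[psi [ips phiK psiK]] E].
by exists psi; split=> // x y; rewrite E !psiK.
Qed.

Lemma DS_sim_trans g f h : DS_sim f g -> DS_sim g h -> DS_sim f h.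
Proof.
case=> phi [[d s] E] [psi [[d' s'] E']]; exists (psi \o phi); split; last first.
  by move=> x y; rewrite E E'.
split=> [x x'|z] /=; first by rewrite d' d.
by have [y <-] := s' z; have [x <-] := s y; exists x.
Qed.

Definition DS_simb : rel DS := fun f g => `[< DS_sim f g >].

Lemma DS_simb_refl : reflexive DS_simb.
Proof. by move=> f; apply/asboolP/DS_sim_refl. Qed.

Lemma DS_simb_sym : symmetric DS_simb.
Proof. by move=> f g; apply/idP/idP => /asboolP/DS_sim_sym/asboolP. Qed.

Lemma DS_simb_trans : transitive DS_simb.
Proof.
by move=> g f h /asboolP fg /asboolP gh; apply/asboolP/(DS_sim_trans fg gh).
Qed.

Canonical DS_sim_equiv :=
  EquivRel DS_simb DS_simb_refl DS_simb_sym DS_simb_trans.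

Definition DSIso := {eq_quot DS_simb}.

Lemma DSIso_eqP (f g : DS) : \pi_DSIso f = \pi_DSIso g <-> DS_sim f g.
Proof. by split=> [/eqmodP/asboolP|fg]; last exact/eqmodP/asboolP. Qed.

Definition DtH (a b : DSIso) : \bar R :=
  ereal_inf [set DH f g | f in [set f | \pi_DSIso f = a] &
                          g in [set g | \pi_DSIso g = b]].

(* Functions are identified with their graphs: f is [is_cmap] when it is the
   graph of a continuous self-map of [DS_dom f]. *)
Definition is_graph (f : DS) (u : DS_dom f -> DS_dom f) : Prop :=
  DS_rel f = range (fun x => (set_val x, set_val (u x))).

Definition is_cmap (f : DS) : Prop :=
  exists u : DS_dom f -> DS_dom f, continuous u /\ is_graph u.

Definition cmap_classes : set DSIso := [set \pi_DSIso f | f in is_cmap].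

(* The map whose graph is f; only meaningful when [is_cmap f], the second
   argument of [xget] being a default value otherwise. *)
Definition map_of (f : DS) (x : DS_dom f) : DS_dom f :=
  xget x [set y : DS_dom f | DS_rel f (set_val x, set_val y)].

(* [dGH0_pi] below shows that on [cmap_classes] the value does not depend on
   the choice of representatives. *)
Definition dGH0 (a b : DSIso) : \bar R :=
  GH0_dist (@map_of (repr a)) (@map_of (repr b)).

End DS.

Arguments map_of {R U}.
Arguments is_cmap {R U}.

Section well_defined.
Context {R : realType} {U : metricType R}.
Implicit Types f g : DS U.

Lemma is_graphP f (u : DS_dom f -> DS_dom f) : is_graph u ->
  forall x y : DS_dom f, DS_rel f (set_val x, set_val y) <-> u x = y.
Proof.
move=> gu x y; split; rewrite gu; last by move=> <-; exists x.
by case=> z _ [] /val_inj-> /val_inj.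
Qed.

Lemma map_of_graph f (u : DS_dom f -> DS_dom f) : is_graph u -> map_of f = u.
Proof.
move=> gu; apply/funext=> x; rewrite /map_of; case: xgetP => [y _ /=|/(_ (u x))].
  by move=> /(is_graphP gu) <-.
by case; apply/(is_graphP gu).
Qed.

Lemma map_ofP f : is_cmap f -> continuous (map_of f) /\ is_graph (map_of f).
Proof. by case=> u [cu gu]; rewrite (map_of_graph gu). Qed.

Lemma map_of_sim f g (phi : DS_dom f -> DS_dom g) :
  is_cmap f -> is_cmap g ->
  (forall x y, DS_rel f (set_val x, set_val y) <->
     DS_rel g (set_val (phi x), set_val (phi y))) ->
  map_of g \o phi = phi \o map_of f.
Proof.
move=> /map_ofP[_ gf] /map_ofP[_ gg] E; apply/funext => x /=.
by apply/(is_graphP gg)/E/(is_graphP gf).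
Qed.

Lemma isometry_continuous (X Y : metricType R) (phi : X -> Y) :
  isometry phi -> continuous phi.
Proof.
move=> [d _] x; apply/metricType_numDomainType.cvgrPdist_lt => e e0.
apply/metricType_numDomainType.nbhs_mdistP; exists e => // y /=.
by rewrite d.
Qed.

Lemma is_cmap_sim f g : DS_sim f g -> is_cmap f -> is_cmap g.
Proof.
case=> phi [iphi E] [u [cu gu]].
have [psi [ipsi phiK psiK]] := DS_sim_inv iphi.
exists (phi \o u \o psi); split.
  move=> y; apply: continuous_comp; first exact: isometry_continuous.
  by apply: continuous_comp; [exact: cu|exact: isometry_continuous].
apply/seteqP; split=> [[a b] gab|_ [x _ <-]].
  have Ma : a \in DS_dom g by apply/mem_set; exists (a, b).
  have Mb : b \in DS_dom g.
    apply/mem_set; have [_ _] := set_valP g.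
    by rewrite /DS_dom /DS_rel set_valE => ->; exists (a, b).
  pose x : DS_dom g := exist _ a Ma; pose y : DS_dom g := exist _ b Mb.
  exists x => //; congr (_, _); rewrite -[RHS]/(set_val y); congr set_val.
  apply: (can_inj psiK); rewrite /= phiK; apply/(is_graphP gu)/E.
  by rewrite !psiK.
by rewrite /= -[x in (set_val x, _)]psiK; apply/E/(is_graphP gu).
Qed.

Lemma hausdorff_dist_isometry (X Y : metricType R) (phi : X -> Y) A B :
  isometry phi -> hausdorff_dist (phi @` A) (phi @` B) = hausdorff_dist A B.
Proof.
move=> [d s]; have H (A' B' : set X) r :
    phi @` A' `<=` \bigcup_(b in phi @` B') ball b r <->
    A' `<=` \bigcup_(b in B') ball b r.
  split=> AB.
    move=> x Ax; have [|_ [b Bb <-]] := AB (phi x); first by exists x.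
    by rewrite ballEmdist /= d => br; exists b => //; rewrite ballEmdist.
  move=> _ [x Ax <-]; have [b Bb br] := AB x Ax.
  exists (phi b); first by exists b.
  by move: br; rewrite !ballEmdist /= d.
congr (ereal_inf (image _ _)); apply/seteqP.
by split=> r [r0 AB BA]; split=> //; apply/H.
Qed.

Lemma eps_isometry_comp (X X' Y Y' : metricType R) e (alpha : X' -> X)
    (beta : Y -> Y') (phi : X -> Y) : isometry alpha -> isometry beta ->
  eps_isometry e phi -> eps_isometry e (beta \o phi \o alpha).
Proof.
move=> [da sa] ib [dp hp]; have [db sb] := ib.
split=> [x x'|] /=; first by rewrite db -da.
rewrite -(hausdorff_dist_isometry _ _ ib) in hp; apply: le_lt_trans hp.
rewrite le_eqVlt; apply/orP; left; apply/eqP; congr hausdorff_dist; apply/seteqP.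
- split=> [_ [x _ <-]|_ [_ [x _ <-] <-]] /=.
    by exists (phi (alpha x)) => //; exists (alpha x).
  by have [z <-] := sa x; exists z.
- by split=> // y _; have [x <-] := sb y; exists x.
Qed.

Lemma dist_C0_isometry (A A' : Type) (B B' : metricType R) (alpha : A' -> A)
    (beta : B -> B') (u v : A -> B) : isometry beta ->
  dist_C0 (beta \o u \o alpha) (beta \o v \o alpha) <= dist_C0 u v.
Proof.
move=> [d _]; apply: ereal_sup_le => _ [x _ <-] /=.
by rewrite d; exists (alpha x).
Qed.

Lemma GH0_dist_conj (X X' Y Y' : metricType R) (f : X -> X) (f' : X' -> X')
    (g : Y -> Y) (g' : Y' -> Y') (a : X -> X') (a' : X' -> X) (b : Y -> Y')
    (b' : Y' -> Y) :
  isometry a -> isometry a' -> cancel a a' -> cancel a' a ->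
  isometry b -> isometry b' -> cancel b b' -> cancel b' b ->
  f' \o a = a \o f -> g' \o b = b \o g ->
  GH0_dist f' g' <= GH0_dist f g.
Proof.
move=> ia ia' aK a'K ib ib' bK b'K fa gb.
have faE x : f' (a x) = a (f x) := congr1 (@^~ x) fa.
have gbE y : g' (b y) = b (g y) := congr1 (@^~ y) gb.
have fa'E x : a' (f' x) = f (a' x) by apply: (can_inj aK); rewrite a'K -faE a'K.
have gb'E y : b' (g' y) = g (b' y) by apply: (can_inj bK); rewrite b'K -gbE b'K.
apply: ereal_inf_le_tmp => _ [e [e0 [phi [psi [ephi epsi dphi dpsi]]]] <-].
exists e => //; split=> //; exists (b \o phi \o a'), (a \o psi \o b').
split; [exact: eps_isometry_comp|exact: eps_isometry_comp| |].
- apply: le_lt_trans dphi; apply: le_trans (dist_C0_isometry a' _ _ ib).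
  rewrite le_eqVlt; apply/orP; left; apply/eqP; congr dist_C0;
    by apply/funext=> x /=; rewrite ?gbE ?fa'E.
- apply: le_lt_trans dpsi; apply: le_trans (dist_C0_isometry b' _ _ ia).
  rewrite le_eqVlt; apply/orP; left; apply/eqP; congr dist_C0;
    by apply/funext=> x /=; rewrite ?faE ?gb'E.
Qed.

Lemma GH0_dist_sim f f' g g' : is_cmap f -> is_cmap g ->
  DS_sim f f' -> DS_sim g g' ->
  GH0_dist (map_of f) (map_of g) = GH0_dist (map_of f') (map_of g').
Proof.
have le f1 f2 g1 g2 : is_cmap f1 -> is_cmap g1 -> DS_sim f1 f2 ->
    DS_sim g1 g2 ->
    GH0_dist (map_of f2) (map_of g2) <= GH0_dist (map_of f1) (map_of g1).
  move=> cf cg ff gg.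
  have cf' := is_cmap_sim ff cf; have cg' := is_cmap_sim gg cg.
  case: ff gg => phi [iphi Ef] [psi [ipsi Eg]].
  have [phi' [iphi' phiK phi'K]] := DS_sim_inv iphi.
  have [psi' [ipsi' psiK psi'K]] := DS_sim_inv ipsi.
  apply: (@GH0_dist_conj _ _ _ _ _ _ _ _ phi phi' psi psi') => //.
    exact: map_of_sim.
  exact: map_of_sim.
move=> cf cg ff gg; apply/eqP; rewrite eq_le; apply/andP; split; apply: le => //.
- exact: is_cmap_sim cf.
- exact: is_cmap_sim cg.
- exact: DS_sim_sym.
- exact: DS_sim_sym.
Qed.

Lemma dGH0_pi f g : is_cmap f -> is_cmap g ->
  dGH0 (\pi_(DSIso U) f) (\pi_(DSIso U) g) = GH0_dist (map_of f) (map_of g).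
Proof.
move=> cf cg; apply/esym/GH0_dist_sim => //; apply/DSIso_eqP;
  by rewrite reprK.
Qed.

End well_defined.

Definition induced_topology (R : realType) (T : Type) (C : set T)
    (d : T -> T -> \bar R) : set (set T) :=
  [set V | V `<=` C /\ forall g, V g ->
     exists2 r : R, (0 < r)%R & C `&` [set f | d f g < r%:E] `<=` V].

(* Main.v *)
Require Import Defs.
From HB Require Import structures.
From mathcomp Require Import all_boot all_order all_algebra generic_quotient.
From mathcomp Require Import all_classical all_reals all_analysis.
From mathcomp Require Import lra.

Set Implicit Arguments.
Unset Strict Implicit.
Unset Printing Implicit Defensive.

Import Order.TTheory GRing.Theory Num.Theory.

Local Open Scope classical_set_scope.
Local Open Scope ring_scope.
Local Open Scope quotient_scope.

(** Both topologies are given by radii around each class, so it is enough that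
around a fixed class of a continuous map g each of the two distances be small
once the other one is.

If D_H(f', g') < e for some conjugates f' of f and g' of g, then every point
(x, f' x) of the first graph has a point (y, g' y) of the second one within e
of it. Choosing such a y as phi(x) moves x and f' x by less than e, so phi
distorts distances by less than 2e, and g' phi and phi f' both stay within e of
f'; the same choice in the other direction gives psi. Hence
d_GH0(f, g) <= 2e ([dGH0_le_DtH]).

Conversely, let phi : M(f) -> M(g) be an e-isometry such that g phi and phi f
are e-close. The disjoint union of M(f) and M(g) becomes a metric space in which
x is at distance at most e/2 from phi(x) ([glue_eps_isometry]). It is separable,
so by universality it embeds in the Urysohn space, and carrying f and g along
the embedding gives conjugates of them there ([DS_copy]). The point (x, f x) is then
within 2e of (phi x, g (phi x)). An arbitrary point (y, g y) of the other graph
is only reached through some x for which phi(x) is e-close to y, and g phi(x) is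
close to g y by the uniform continuity of g ([DtH_le_eps_isometry]). The bound
thus depends on the modulus of continuity of g: the two distances are not
compared uniformly, but g is fixed, and this is enough for the topologies. *)

(** * Distance-preserving maps, Hausdorff and uniform distances *)

Definition dist_preserving (R : realType) (X Y : metricType R) (h : X -> Y) :=
  forall x x', mdist (h x) (h x') = mdist x x'.

Lemma dist_preserving_continuous (R : realType) (X Y : metricType R)
    (h : X -> Y) : dist_preserving h -> continuous h.
Proof.
move=> dh x; apply/metricType_numDomainType.cvgrPdist_lt => e e0.
apply/metricType_numDomainType.nbhs_mdistP; exists e => // y /=.
by rewrite dh.
Qed.

Section hausdorff.
Context {R : realType} {T : metricType R}.
Implicit Types A B : set T.

Lemma hausdorff_dist_ltP A B (e : R) : (hausdorff_dist A B < e%:E)%E ->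
  exists r, [/\ 0 < r, r < e,
    forall a, A a -> exists2 b, B b & mdist a b < r &
    forall b, B b -> exists2 a, A a & mdist a b < r].
Proof.
move=> /ereal_inf_lt[_ [r [r0 AB BA] <-]]; rewrite lte_fin => re.
exists r; split=> //.
  move=> a /AB[b Bb]; rewrite ballEmdist /= => ba.
  by exists b => //; rewrite metric_sym.
by move=> b /BA[a Aa]; rewrite ballEmdist /= => ab; exists a.
Qed.

Lemma hausdorff_dist_le A B (r : R) : 0 < r ->
  (forall a, A a -> exists2 b, B b & mdist a b < r) ->
  (forall b, B b -> exists2 a, A a & mdist a b < r) ->
  (hausdorff_dist A B <= r%:E)%E.
Proof.
move=> r0 AB BA; apply: ereal_inf_lbound; exists r => //; split=> //.
  by move=> a /AB[b Bb ab]; exists b => //; rewrite ballEmdist /= metric_sym.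
by move=> b /BA[a Aa ab]; exists a => //; rewrite ballEmdist.
Qed.

End hausdorff.

Lemma dist_C0_le (R : realType) (A : Type) (B : metricType R) (u v : A -> B)
    (r : R) :
  (forall a, mdist (u a) (v a) <= r) -> (dist_C0 u v <= r%:E)%E.
Proof. by move=> uv; apply: ge_ereal_sup => _ [a _ <-]; rewrite lee_fin. Qed.

Lemma dist_C0_lt (R : realType) (A : Type) (B : metricType R) (u v : A -> B)
    (r : R) :
  (dist_C0 u v < r%:E)%E -> forall a, mdist (u a) (v a) < r.
Proof.
move=> uv a; rewrite -lte_fin; apply: le_lt_trans uv.
by apply: ereal_sup_ubound; exists a.
Qed.

Lemma dist_C0_sym (R : realType) (A : Type) (B : metricType R) (u v : A -> B) :
  dist_C0 u v = dist_C0 v u.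
Proof.
by rewrite /dist_C0; under eq_fun do rewrite metric_sym.
Qed.

(** * From close copies to approximate isometries *)

Section close_copies.
Context {R : realType} {V : metricType R}.

(** Two systems copied into a common space [V] by [h] and [k]: when [h] and [k]
preserve distances, this says that the graphs of the two copies are close for
the Hausdorff distance on [V * V] with the max-metric. *)
Definition close_systems (X Y : metricType R) (h : X -> V) (k : Y -> V)
    (u : X -> X) (v : Y -> Y) (r : R) :=
  (forall x, exists y, mdist (h x) (k y) < r /\ mdist (h (u x)) (k (v y)) < r)
  /\
  (forall y, exists x, mdist (h x) (k y) < r /\ mdist (h (u x)) (k (v y)) < r).

Lemma close_systems_sym (X Y : metricType R) (h : X -> V) (k : Y -> V) u v r :
  close_systems h k u v r -> close_systems k h v u r.
Proof.
case=> xy yx; split=> [y|x].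
  by have [x ?] := yx y; exists x; rewrite ![mdist (k _) _]metric_sym.
by have [y ?] := xy x; exists y; rewrite ![mdist (k _) _]metric_sym.
Qed.

(** [phi x] is any point whose orbit segment of length one is close to that of
[x]; the two conditions on the pairs [(x, u x)] and [(phi x, v (phi x))] bound
respectively the distortion of [phi] and its failure to commute with the
dynamics. *)
Lemma close_systems_eps_isometry (X Y : metricType R) (h : X -> V) (k : Y -> V)
    u v (r e : R) :
  dist_preserving h -> dist_preserving k -> 0 < r -> r < e ->
  close_systems h k u v r ->
  exists phi : X -> Y, eps_isometry (2 * e) phi /\
    (dist_C0 (v \o phi) (phi \o u) < (2 * e)%:E)%E.
Proof.
move=> dh dk r0 re [xy yx]; have [phi phiP] := choice xy.
exists phi; split; last first.
  apply: (@le_lt_trans _ _ (2 * r)%:E); last by rewrite lte_fin; lra.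
  apply: dist_C0_le => x /=; rewrite -dk.
  have := metric_triangle (k (v (phi x))) (h (u x)) (k (phi (u x))).
  have [_] := phiP x; have [+ _] := phiP (u x).
  rewrite [mdist (k _) (h _)]metric_sym; lra.
split=> [x x'|].
  rewrite -dh -dk; have [p _] := phiP x; have [p' _] := phiP x'.
  have := metric_triangle (h x) (k (phi x)) (h x').
  have := metric_triangle (k (phi x)) (k (phi x')) (h x').
  have := metric_triangle (k (phi x)) (h x) (k (phi x')).
  have := metric_triangle (h x) (h x') (k (phi x')).
  rewrite [mdist (k (phi x')) (h x')]metric_sym.
  by rewrite [mdist (k (phi x)) (h x)]metric_sym ltr_norml; lra.
apply: (@le_lt_trans _ _ (2 * r)%:E); last by rewrite lte_fin; lra.
apply: hausdorff_dist_le; first lra.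
  by move=> y _; exists y => //; rewrite mdistxx; lra.
move=> y _; have [x [xy1 _]] := yx y; exists (phi x) => //.
rewrite -dk; have := metric_triangle (k (phi x)) (h x) (k y).
by have [] := phiP x; rewrite [mdist (k _) (h _)]metric_sym; lra.
Qed.

Lemma close_systems_GH0 (X Y : metricType R) (h : X -> V) (k : Y -> V)
    u v (r e : R) :
  dist_preserving h -> dist_preserving k -> 0 < r -> r < e ->
  close_systems h k u v r -> (GH0_dist u v <= (2 * e)%:E)%E.
Proof.
move=> dh dk r0 re huv; apply: ereal_inf_lbound; exists (2 * e) => //.
split; first lra.
have [phi [iphi dphi]] := close_systems_eps_isometry dh dk r0 re huv.
have [psi [ipsi dpsi]] :=
  close_systems_eps_isometry dk dh r0 re (close_systems_sym huv).
by exists phi, psi; split=> //; rewrite dist_C0_sym.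
Qed.

End close_copies.

(** * Gluing two spaces along an approximate isometry *)

Section glue.
Context {R : realType} {X Y : metricType R} (phi : X -> Y) (e : R) (x0 : X).
Hypothesis e0 : 0 < e.
Hypothesis phiD : forall x x', `|mdist (phi x) (phi x') - mdist x x'| <= 2 * e.

(** [X] and [Y] are joined by bridges of length [e], one from each [x'] to
[phi x']. A path that crosses two bridges pays [2 * e] for them, which makes up
for the distortion of [phi], so that no distance inside [X] or inside [Y] is
shortened. *)
Let lengths x y := range (fun x' => mdist x x' + e + mdist (phi x') y).
Definition cross_dist x y : R := inf (lengths x y).

Let lengths_lb x y : lbound (lengths x y) e.
Proof.
move=> _ [x' _ <-]; have := mdist_ge0 x x'; have := mdist_ge0 (phi x') y; lra.
Qed.

Lemma cross_dist_le x x' y :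
  cross_dist x y <= mdist x x' + e + mdist (phi x') y.
Proof. by apply: ge_inf; [by exists e; exact: lengths_lb | by exists x']. Qed.

Lemma le_cross_dist c x y :
  (forall x', c <= mdist x x' + e + mdist (phi x') y) -> c <= cross_dist x y.
Proof.
move=> H; apply: lb_le_inf; last by move=> _ [x' _ <-]; exact: H.
by exists (mdist x x0 + e + mdist (phi x0) y), x0.
Qed.

Lemma cross_dist_ge x y : e <= cross_dist x y.
Proof. by apply: le_cross_dist => x'; apply: lengths_lb; exists x'. Qed.

Lemma cross_dist_triangleX x1 x2 y :
  cross_dist x1 y <= mdist x1 x2 + cross_dist x2 y.
Proof.
rewrite -lerBlDl; apply: le_cross_dist => x'.
have := cross_dist_le x1 x' y; have := metric_triangle x1 x2 x'; lra.
Qed.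

Lemma cross_dist_triangleY x y1 y2 :
  cross_dist x y1 <= cross_dist x y2 + mdist y2 y1.
Proof.
rewrite -lerBlDr; apply: le_cross_dist => x'.
have := cross_dist_le x x' y1; have := metric_triangle (phi x') y2 y1; lra.
Qed.

Lemma le_cross_distX x1 x2 y : mdist x1 x2 <= cross_dist x1 y + cross_dist x2 y.
Proof.
rewrite -lerBlDr; apply: le_cross_dist => x'.
rewrite lerBlDr -lerBlDl; apply: le_cross_dist => x''.
have := metric_triangle x1 x' x2; have := metric_triangle x' x'' x2.
have := metric_triangle (phi x') y (phi x''); rewrite [mdist y _]metric_sym.
rewrite [mdist x'' x2]metric_sym.
have := phiD x' x''; rewrite ler_norml; lra.
Qed.

Lemma le_cross_distY x y1 y2 : mdist y1 y2 <= cross_dist x y1 + cross_dist x y2.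
Proof.
rewrite -lerBlDr; apply: le_cross_dist => x'.
rewrite lerBlDr -lerBlDl; apply: le_cross_dist => x''.
have := metric_triangle y1 (phi x') y2.
have := metric_triangle (phi x') (phi x'') y2.
rewrite [mdist y1 (phi x')]metric_sym.
have := metric_triangle x' x x''; rewrite [mdist x' x]metric_sym.
have := phiD x' x''; rewrite ler_norml; lra.
Qed.

Definition glued : Type := (X + Y)%type.

Definition glued_dist (a b : glued) : R :=
  match a, b with
  | inl x, inl x' => mdist x x'
  | inl x, inr y => cross_dist x y
  | inr y, inl x => cross_dist x y
  | inr y, inr y' => mdist y y'
  end.

Lemma glued_distxx a : glued_dist a a = 0.
Proof. by case: a => a /=; rewrite mdistxx. Qed.

Lemma glued_dist_positivity a b : glued_dist a b = 0 -> a = b.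
Proof.
by case: a b => [x|y] [x'|y'] /=; try (by move=> /mdist_positivity->);
  move=> D0; [have := cross_dist_ge x y' | have := cross_dist_ge x' y];
  rewrite D0 leNgt e0.
Qed.

Lemma glued_dist_sym a b : glued_dist a b = glued_dist b a.
Proof. by case: a b => [x|y] [x'|y'] //=; rewrite metric_sym. Qed.

Lemma glued_dist_triangle b a c :
  glued_dist a c <= glued_dist a b + glued_dist b c.
Proof.
case: a b c => [x1|y1] [x2|y2] [x3|y3] /=.
- exact: metric_triangle.
- exact: cross_dist_triangleX.
- exact: le_cross_distX.
- exact: cross_dist_triangleY.
- by rewrite addrC metric_sym; exact: cross_dist_triangleX.
- exact: le_cross_distY.
- by rewrite addrC metric_sym; exact: cross_dist_triangleY.
- exact: metric_triangle.
Qed.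

HB.instance Definition _ := Choice.on glued.
HB.instance Definition _ := isMetric.Build R glued glued_distxx
  glued_dist_positivity glued_dist_sym glued_dist_triangle.

Lemma glue_eps_isometry : exists (Z : metricType R) (i : X -> Z) (j : Y -> Z),
  [/\ dist_preserving i, dist_preserving j,
      forall x, mdist (i x) (j (phi x)) <= e &
      forall z, (exists x, z = i x) \/ (exists y, z = j y)].
Proof.
exists glued, inl, inr; split=> //; last first.
  by case=> [x|y]; [left; exists x | right; exists y].
by move=> x; apply: le_trans (cross_dist_le x x _) _; rewrite !mdistxx; lra.
Qed.

End glue.

(** * Separability *)

Section separability.
Context {R : realType}.
Implicit Types X Y Z : metricType R.

Lemma separableP X : separable X <->
  exists2 D : set X, countable D &
    forall x (r : R), 0 < r -> exists2 a, D a & mdist x a < r.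
Proof.
split=> [[D [cD dD]]|[D cD dD]].
  exists D => // x r r0.
  have [|a [/interior_subset]] := dD (ball x r)° _ (@open_interior _ _).
    by exists x; exact: nbhsx_ballx.
  by rewrite ballEmdist; exists a.
exists D; split=> // O [x Ox] oO.
have /metricType_numDomainType.nbhs_mdistP[r /= r0 rO] : nbhs x O.
  exact: open_nbhs_nbhs.
by have [a Da /rO Oa] := dD x r r0; exists a.
Qed.

(** Separability passes to subspaces of a metric space although a dense subset
of [Y] may miss [X]: it is enough to pick, for each dense point [a] and each
[n], one point of [X] within [n.+1%:R^-1] of [a], if there is one. *)
Lemma separable_dist_preserving X Y (h : X -> Y) (x0 : X) :
  dist_preserving h -> separable Y -> separable X.
Proof.
move=> dh /separableP[D cD dD]; apply/separableP.
pose near_pt (p : Y * nat) :=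
  xget x0 [set x | mdist (h x) p.1 < p.2.+1%:R^-1].
exists (near_pt @` (D `*` setT)).
  exact: (sub_countable (card_image_le _ _) (countableX cD (countableP _))).
move=> x r r0; have r2 : 0 < r / 2 by rewrite divr_gt0.
have [n] := ltr_add_invr r2; rewrite add0r => nr.
have [//|a Da xa] := dD (h x) n.+1%:R^-1.
exists (near_pt (a, n)); first by exists (a, n).
rewrite /near_pt; case: xgetP => [z _ /= za|/(_ x)]; last by case.
rewrite -dh; have := metric_triangle (h x) a (h z).
rewrite [mdist a _]metric_sym; have := lt_trans xa nr; have := lt_trans za nr.
lra.
Qed.

Lemma separable_union X Y Z (i : X -> Z) (j : Y -> Z) :
  dist_preserving i -> dist_preserving j ->
  (forall z, (exists x, z = i x) \/ (exists y, z = j y)) ->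
  separable X -> separable Y -> separable Z.
Proof.
move=> di dj ij /separableP[D cD dD] /separableP[E cE dE]; apply/separableP.
exists (i @` D `|` j @` E).
  rewrite -bigcup2E; apply: bigcup_countable => // -[|[|n]] _ //=.
  - exact: (sub_countable (card_image_le _ _) cD).
  - exact: (sub_countable (card_image_le _ _) cE).
move=> z r r0; have [[x ->]|[y ->]] := ij z.
  by have [a Da xa] := dD x r r0; exists (i a); [left; exists a | rewrite di].
by have [a Ea ya] := dE y r r0; exists (j a); [right; exists a | rewrite dj].
Qed.

End separability.

(** * Compactness *)

(** The subtype is the image of [A] under the inverse of the inclusion, which is
continuous on [A] since the topology of the subtype is the induced one. *)
Lemma compact_set_type (T : topologicalType) (A : set T) :
  compact A -> compact [set: A].
Proof.
move=> cA; have [[x0]|noA] := pselect (inhabited A); last first.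
  have -> : [set: A] = set0 by rewrite -subset0 => x _; apply: noA; exists.
  exact: compact0.
have -> : [set: A] = insubd x0 @` A.
  apply/seteqP; split=> // x _; exists (set_val x); first exact: set_valP.
  exact: valKd.
apply: continuous_compact cA; apply/subspace_sigL_continuousP.
have -> : sigL A (insubd x0) = id by apply/funext => x; exact: valKd.
by move=> x.
Qed.

(** The Heine-Cantor theorem. *)
Lemma compact_unif_continuous (R : realType) (X Y : metricType R) (u : X -> Y) :
  compact [set: X] -> continuous u -> forall e : R, 0 < e ->
  exists2 d, 0 < d & forall x x', mdist x x' < d -> mdist (u x) (u x') < e.
Proof.
move=> /compact_near_coveringP cX cu e e0.
pose P (d : R) x := forall x', mdist x x' < d -> mdist (u x) (u x') < e.
have e2 : 0 < e / 2 by rewrite divr_gt0.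
have : \forall d \near 0^'+, [set: X] `<=` P d.
  apply: cX => x _.
  have /metricType_numDomainType.cvgrPdist_lt/(_ _ e2) := cu x.
  move=> /metricType_numDomainType.nbhs_mdistP[r /= r0 ru].
  have r2 : 0 < r / 2 by rewrite divr_gt0.
  exists (ball x (r / 2), [set d | d < r / 2]).
    by split; [exact: nbhsx_ballx | exact: nbhs_right_lt].
  case=> y d [/=]; rewrite ballEmdist /= => xy dr y' yy'.
  have yx : mdist x y < r by lra.
  have y'x : mdist x y' < r by have := metric_triangle x y y'; lra.
  have := ru _ yx; have := ru _ y'x => /=.
  have := metric_triangle (u y) (u x) (u y').
  by rewrite [mdist (u y) (u x)]metric_sym; lra.
move=> H; have [d [/= d0 Pd]] := filter_ex (filterI (nbhs_right_gt 0) H).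
by exists d => // x x' xx'; apply: (Pd x).
Qed.

(** * Dynamical systems in the universal space *)

Section systems.
Context {R : realType} {U : metricType R}.
Implicit Types f g : DS U.

Lemma DS_dom_inhabited f : inhabited (DS_dom f).
Proof.
have [[p fp] _ _] := set_valP f; exists.
by exists p.1; apply/mem_set; exists p.
Qed.

Lemma compact_DS_dom f : compact [set: DS_dom f].
Proof.
apply: compact_set_type; have [_ cf _] := set_valP f.
apply: continuous_compact cf; apply: continuous_subspaceT => p.
exact: cvg_fst.
Qed.

(** This is what the condition [fst @` f = snd @` f] means for a graph. *)
Lemma map_of_surj f : is_cmap f -> forall y, exists x, map_of f x = y.
Proof.
move=> /map_ofP[_ gf] y; have [_ _ fst_snd] := set_valP f.
have [[a b] /= fab by_] : (snd @` DS_rel f) (set_val y).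
  by rewrite /DS_rel -fst_snd; exact: set_valP.
have Ma : a \in DS_dom f by apply/mem_set; exists (a, b).
by exists (exist _ a Ma); apply/(is_graphP gf); rewrite -by_.
Qed.

(** Isometric conjugacy only involves the domains of the systems, so a system
can be moved along any distance-preserving map of its domain. *)
Lemma DS_copy f (h : DS_dom f -> U) : is_cmap f -> dist_preserving h ->
  exists2 f' : DS U, \pi_(DSIso U) f' = \pi_(DSIso U) f &
    DS_rel f' = range (fun x => (h x, h (map_of f x))).
Proof.
move=> cf dh; set S := range _; have [cu gf] := map_ofP cf.
have SD : DS_set S.
  have [x0] := DS_dom_inhabited f; split.
  - by exists (h x0, h (map_of f x0)), x0.
  - apply: continuous_compact (@compact_DS_dom f).
    apply: continuous_subspaceT => x.
    have ch := dist_preserving_continuous dh.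
    apply: cvg_pair; [exact: nbhs_filter | exact: ch |].
    by apply: (continuous_comp (cu x)); exact: ch.
  - apply/seteqP; split=> [_ [_ [x _ <-] <-]|_ [_ [x _ <-] <-]] /=.
      have [z zx] := map_of_surj cf x.
      by exists (h z, h (map_of f z)); [exists z | rewrite zx].
    exists (h (map_of f x), h (map_of f (map_of f x))) => //.
    by exists (map_of f x).
pose f' : DS U := exist _ S (mem_set SD).
exists f' => //; apply/esym/DSIso_eqP.
have Mh x : h x \in DS_dom f'.
  by apply/mem_set; exists (h x, h (map_of f x)) => //; exists x.
have hI : injective h.
  by move=> x x' hxx; apply: mdist_positivity; rewrite -dh hxx mdistxx.
exists (fun x => exist _ (h x) (Mh x)); split.
  split=> [x x'|[y My]]; first by rewrite mdist_subE; exact: dh.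
  have /set_mem[_ [x _ <-] /= xy] := My.
  by exists x; apply: val_inj.
move=> x y; rewrite (is_graphP gf); split=> [<-|[z _ [/hI-> /hI]]//].
by exists x.
Qed.

Lemma DtH_lt (a b : DSIso U) (e : R) : (DtH a b < e%:E)%E ->
  exists f g, [/\ \pi f = a, \pi g = b & (DH f g < e%:E)%E].
Proof.
by move=> /ereal_inf_lt[_ [f fa [g gb <-]] fg]; exists f, g.
Qed.

Lemma is_cmap_pi f : cmap_classes (\pi_(DSIso U) f) -> is_cmap f.
Proof. by case=> g cg /DSIso_eqP gf; exact: is_cmap_sim gf cg. Qed.

Lemma dGH0_le_DtH (a b : DSIso U) (e : R) :
  cmap_classes a -> cmap_classes b ->
  (DtH a b < e%:E)%E -> (dGH0 a b <= (2 * e)%:E)%E.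
Proof.
move=> Ca Cb /DtH_lt[f [g [fa gb fg]]]; move: Ca Cb; rewrite -fa -gb.
move=> /is_cmap_pi cf /is_cmap_pi cg; rewrite dGH0_pi//.
have [r [r0 re fgr gfr]] := hausdorff_dist_ltP fg.
have [_ gf] := map_ofP cf; have [_ gg] := map_ofP cg.
apply: (@close_systems_GH0 _ U _ _ set_val set_val _ _ r) => //.
split=> [x|y].
  have [|q +] := fgr (set_val x, set_val (map_of f x)).
    by rewrite gf; exists x.
  rewrite gg => -[y _ <-]; rewrite mdist_prodE gt_max => /andP[/= ? ?].
  by exists y.
have [|q +] := gfr (set_val y, set_val (map_of g y)).
  by rewrite gg; exists y.
rewrite gf => -[x _ <-]; rewrite mdist_prodE gt_max => /andP[/= ? ?].
by exists x.
Qed.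

Lemma DtH_le_close f g (h : DS_dom f -> U) (k : DS_dom g -> U) (r : R) :
  is_cmap f -> is_cmap g -> dist_preserving h -> dist_preserving k -> 0 < r ->
  close_systems h k (map_of f) (map_of g) r ->
  (DtH (\pi_(DSIso U) f) (\pi_(DSIso U) g) <= r%:E)%E.
Proof.
move=> cf cg dh dk r0 [xy yx].
have [f' ff' Ef'] := DS_copy cf dh; have [g' gg' Eg'] := DS_copy cg dk.
apply: (@le_trans _ _ (DH f' g')).
  by apply: ereal_inf_lbound; exists f' => //; exists g'.
rewrite /DH Ef' Eg'; apply: hausdorff_dist_le => //.
  move=> _ [x _ <-]; have [y [? ?]] := xy x.
  exists (k y, k (map_of g y)); first by exists y.
  by rewrite mdist_prodE gt_max; apply/andP.
move=> _ [y _ <-]; have [x [? ?]] := yx y.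
exists (h x, h (map_of f x)); first by exists x.
by rewrite mdist_prodE gt_max; apply/andP.
Qed.

Lemma universal_embedding (V X : metricType R) : universal V -> separable X ->
  exists h : X -> V, dist_preserving h.
Proof.
move=> uV sX; have [A [phi [dphi _]]] := uV X sX.
by exists (set_val \o phi) => x x'; rewrite -dphi.
Qed.

(** The modulus of continuity of the map of [g] enters, through [d],
because an arbitrary [y] is only [e]-close to the range of [phi]. *)
Lemma DtH_le_eps_isometry f g (phi : DS_dom f -> DS_dom g) (e d : R) :
  separable U -> universal U -> is_cmap f -> is_cmap g ->
  eps_isometry e phi ->
  (forall x, mdist (map_of g (phi x)) (phi (map_of f x)) < e) ->
  (forall y y', mdist y y' < e -> mdist (map_of g y) (map_of g y') < d) ->
  (DtH (\pi_(DSIso U) f) (\pi_(DSIso U) g) <= (2 * e + d)%:E)%E.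
Proof.
move=> sU uU cf cg [phiD /hausdorff_dist_ltP[r [r0 re _ phiY]]] gphi guc.
have [x0] := DS_dom_inhabited f.
have e2 : 0 < e / 2 by lra.
have phiD2 x x' : `|mdist (phi x) (phi x') - mdist x x'| <= 2 * (e / 2).
  by have := phiD x x'; lra.
have [Z [i [j [di dj ij Zij]]]] := glue_eps_isometry x0 e2 phiD2.
have set_val_dist (A : set U) : dist_preserving (set_val : A -> U) by [].
have sZ : separable Z.
  apply: (separable_union di dj Zij).
    exact: (separable_dist_preserving x0 (@set_val_dist _) sU).
  exact: (separable_dist_preserving (phi x0) (@set_val_dist _) sU).
have [h dh] := universal_embedding uU sZ.
have d0 : 0 < d.
  apply: le_lt_trans (guc (phi x0) (phi x0) _); first exact: mdist_ge0.
  by rewrite mdistxx; lra.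
have hphi x : mdist (h (i (map_of f x))) (h (j (map_of g (phi x)))) < 2 * e.
  rewrite dh; have := ij (map_of f x); have := gphi x.
  have := metric_triangle (i (map_of f x)) (j (phi (map_of f x)))
                          (j (map_of g (phi x))).
  by rewrite dj [mdist (map_of g _) _]metric_sym; lra.
apply: (@DtH_le_close _ _ (h \o i) (h \o j)) => //.
- by move=> x x'; rewrite /= dh di.
- by move=> y y'; rewrite /= dh dj.
- lra.
split=> [x|y].
  exists (phi x); split; last by have /= := hphi x; lra.
  by rewrite /= dh; have := ij x; lra.
have [_ [x _ <-] xy] := phiY y I; exists x => /=.
have xye : mdist (phi x) y < e by lra.
split.
  rewrite dh; have := metric_triangle (i x) (j (phi x)) (j y).
  by rewrite dj; have := ij x; lra.
(* From the image of [f x] to that of [g y] through the image of [g (phi x)]: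
   [2 * e] by the choice of [phi], and [d] by uniform continuity. *)
have := metric_triangle (h (i (map_of f x))) (h (j (map_of g (phi x))))
                        (h (j (map_of g y))).
have := hphi x; have := guc _ _ xye.
by rewrite [mdist (h (j _)) (h (j _))]dh dj; lra.
Qed.

End systems.

Lemma induced_topology_le (R : realType) (T : Type) (C : set T)
    (d d' : T -> T -> \bar R) :
  (forall g (r : R), C g -> 0 < r -> exists2 s : R, 0 < s &
     forall f, C f -> (d' f g < s%:E)%E -> (d f g < r%:E)%E) ->
  induced_topology C d `<=` induced_topology C d'.
Proof.
move=> dd' V [VC Vd]; split=> // g Vg; have [r r0 rV] := Vd g Vg.
have [s s0 sr] := dd' g r (VC g Vg) r0; exists s => // f [Cf fg].
by apply: rV; split=> //; exact: sr.
Qed.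

Theorem theorem3p10 (R : realType) (U : metricType R) (hU : urysohn U) :
  induced_topology (@cmap_classes R U) (@DtH R U) =
  induced_topology (@cmap_classes R U) (@dGH0 R U).
Proof.
have [_ sU uU _] := hU.
apply/seteqP; split; apply: induced_topology_le => b r Cb r0; last first.
  exists (r / 3) => [|a Ca ab]; first lra.
  apply: le_lt_trans (dGH0_le_DtH Ca Cb ab) _.
  by rewrite lte_fin; lra.
case: Cb => g cg <-; have [cu _] := map_ofP cg.
have r2 : 0 < r / 2 by lra.
have [d d0 gd] := compact_unif_continuous (@compact_DS_dom _ _ g) cu r2.
(* [DtH_le_eps_isometry] gives the bound [2 * e + r / 2], whence [e < r / 4]. *)
exists (Num.min d (r / 4)); first by rewrite lt_min d0; lra.
move=> _ [f cf <-]; rewrite dGH0_pi//.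
move=> /ereal_inf_lt[_ [e [e0 [phi [_ [ephi _ /dist_C0_lt gphi _]]]] <-]].
rewrite lte_fin lt_min => /andP[ed er].
apply: le_lt_trans (DtH_le_eps_isometry sU uU cf cg ephi gphi _) _.
  by move=> y y' yy'; apply: gd; exact: lt_trans ed.
by rewrite lte_fin; lra.
Qed.
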